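(* Let $q\ge 2$ be an integer and let $p_0,\dots,p_{q-1}$ be non-negative real numbers with $\sum_{j=0}^{q-1}p_j=1$ and $p_j\neq1$ for every $j$. Put $p_{\max}=\max_{0\le j\le q-1}p_j$. Let $x_1,x_2,\dots$ be independent, identically distributed random variables with $\mathbb{P}[x_i=j]=p_j$ for $j\in\{0,\dots,q-1\}$, let $X=\sum_{i=1}^\infty x_iq^{-i}$ and $F(x)=\mathbb{P}[X\le x]$. Define functions $f_n\colon[0,1]\to\mathbb{R}$ by $f_0(x)=x$ and $f_{n+1}=Tf_n$ for $n\ge0$, where $T$ is the operator defined in the context. Then: (i) $f_n\to F$ in $C[0,1]$ with respect to the sup-norm $\|\cdot\|_\infty$ on $[0,1]$; (ii) $\displaystyle \|x-F(x)\|_\infty\le\left(\frac{1}{1-p_{\max}}\right)\|x-f_1(x)\|_\infty$, where the norms are sup-norms over $x\in[0,1]$.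
   Context: For a function $f$ on $[0,1]$, $Tf$ is defined by: for $k\in\{0,\dots,q-1\}$ and $\frac{k}{q}\le x\le\frac{k+1}{q}$, $$(Tf)(x)=\sum_{j=0}^{k-1}p_j+p_k\,f(qx-k),$$ with the empty sum equal to $0$. For continuous $f$ with $f(0)=0$ and $f(1)=1$ the two formulas at each breakpoint $k/q$ agree, and $Tf$ is again continuous with $Tf(0)=0$, $Tf(1)=1$; in particular all $f_n$ are well defined. *)

(* Defs.v *)
From HB Require Import structures.
From mathcomp Require Import all_boot all_order all_algebra finmap.
From mathcomp Require Import all_classical all_reals all_analysis.
From mathcomp Require Import measurable_realfun.
From mathcomp Require Import ring lra.

Set Implicit Arguments.
Unset Strict Implicit.
Unset Printing Implicit Defensive.

Import Order.TTheory GRing.Theory Num.Theory.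
Import numFieldNormedType.Exports.

Local Open Scope classical_set_scope.
Local Open Scope ring_scope.

(* Mutual independence of a family of random variables: the product rule over
   every finite subfamily. *)
Definition independent_RVs (I : choiceType) (d : measure_display)
    (T : measurableType d) (R : realType) (P : probability T R)
    (x : I -> {RV P >-> R}) : Prop :=
  forall (J : {fset I}) (A : I -> set R),
    (forall i, i \in J -> measurable (A i)) ->
    P (\bigcap_(i in [set` J]) (x i @^-1` A i)) =
    (\prod_(i <- J) P (x i @^-1` A i))%E.

Arguments independent_RVs {I d T R} P x.

Section digit_series.
Context (d : measure_display) (T : measurableType d) (R : realType).
Variable P : probability T R.

Lemma measurable_fun_limn (h : (T -> R)^nat) :
  (forall n, measurable_fun [set: T] (h n)) ->
  measurable_fun [set: T] (fun t => limn (h ^~ t)).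
Proof.
move=> mh.
pose C := [set t | cvgn (h ^~ t)].
have CE : C = \bigcap_k \bigcup_N \bigcap_(n in [set n | (N <= n)%N])
    [set t | `|h n t - h N t| < k.+1%:R^-1].
  apply/seteqP; split => t.
    move=> /cvg_cauchy/cauchyP Ch k _.
    have e0 : (0 : R) < k.+1%:R^-1 / 2 by rewrite divr_gt0// invr_gt0.
    have [y [N _ hN]] := Ch _ e0.
    exists N => // n /= Nn.
    have := hN n Nn; have := hN N (leqnn N); rewrite -!ball_normE /= => h1 h2.
    rewrite (_ : _ - _ = (h n t - y) - (h N t - y)); last by ring.
    rewrite (le_lt_trans (ler_normB _ _))// [ltRHS]splitr.
    by rewrite ltrD// distrC.
  move=> Ct; apply/cauchy_cvgP/cauchyP => e e0.
  have [k ke] : exists k, k.+1%:R^-1 < e.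
    have [k _ /(_ k (leqnn k)) hk] := near_infty_natSinv_lt (PosNum e0).
    by exists k.
  have [N _ hN] := Ct k I.
  exists (h N t); exists N => // n /= Nn.
  by rewrite -ball_normE /= distrC (lt_trans (hN n Nn)).
have mC : measurable C.
  rewrite CE; apply: bigcapT_measurable => k.
  apply: bigcup_measurable => N _; apply: bigcap_measurable => [|n Nn].
    by exists N => /=.
  rewrite -[X in measurable X]setTI.
  have mf : measurable_fun [set: T] (fun t => `|h n t - h N t|).
    by apply: measurableT_comp => //; apply: measurable_funB.
  rewrite (_ : [set t | _] = (fun t => `|h n t - h N t|) @^-1` `]-oo, k.+1%:R^-1[).
    exact: mf.
  by apply/seteqP; split => t /=; rewrite in_itv.
rewrite -(setvU C) measurable_funU//; last exact: measurableC.
split.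
  apply: (@eq_measurable_fun _ _ _ _ _ (cst point)).
    move=> t; rewrite inE /= => nC.
    by rewrite dvgP.
  exact: measurable_cst.
apply: (@measurable_fun_cvg _ _ _ _ h) => [n|t Ct].
  exact: measurable_funTS.
exact: Ct.
Qed.

(* The digit of weight q^-i is indexed here by i - 1. Digits are only almost
   surely in {0, ..., q - 1}; where the series diverges, limn is a default. *)
Definition digit_series (q : nat) (x : nat -> {RV P >-> R}) (t : T) : R :=
  limn (fun n => \sum_(0 <= i < n) x i t * q%:R ^- i.+1).

Lemma measurable_digit_series q x : measurable_fun [set: T] (digit_series q x).
Proof.
apply: measurable_fun_limn => n; apply: measurable_sum => i.
exact: measurable_funM.
Qed.

HB.instance Definition _ q x :=
  isMeasurableFun.Build _ _ _ _ (digit_series q x) (measurable_digit_series q x).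

End digit_series.

Section operator.
Context (R : realType) (q : nat).

Definition digit_cell (k : 'I_q) (x : R) : bool :=
  (k%:R / q%:R <= x) && (x <= k.+1%:R / q%:R).

(* The least k is picked at the breakpoints; the choice is immaterial when
   f 0 = 0 and f 1 = 1, see digit_operatorE. The value 0 outside [0, 1] is
   never used. *)
Definition digit_operator (p : 'I_q -> R) (f : R -> R) (x : R) : R :=
  if [pick k | digit_cell k x] is Some k then
    \sum_(j < q | (j < k)%N) p j + p k * f (q%:R * x - k%:R)
  else 0.

Lemma digit_operatorE p f k x : f 0 = 0 -> f 1 = 1 -> digit_cell k x ->
  digit_operator p f x =
  \sum_(j < q | (j < k)%N) p j + p k * f (q%:R * x - k%:R).
Proof.
move=> f0 f1 kx.
have q0 : (0 : R) < q%:R by rewrite ltr0n (leq_ltn_trans _ (ltn_ord k)).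
rewrite /digit_operator; case: pickP => [l lx|]; last by move/(_ k); rewrite kx.
suff H (a b : 'I_q) : digit_cell a x -> digit_cell b x -> (a < b)%N ->
    \sum_(j < q | (j < a)%N) p j + p a * f (q%:R * x - a%:R) =
    \sum_(j < q | (j < b)%N) p j + p b * f (q%:R * x - b%:R).
  have [lk|kl|/val_inj -> //] := ltngtP l k; first exact: H.
  by apply/esym/H.
rewrite /digit_cell !ler_pdivrMr// !ler_pdivlMr// mulrC.
move=> /andP[_ xa] /andP[bx _] ab.
have ba : b = a.+1 :> nat.
  by apply/eqP; rewrite eqn_leq ab andbT -(ler_nat R) (le_trans bx).
have qx : q%:R * x = b%:R.
  by apply/eqP; rewrite eq_le bx ba xa.
have ba1 : b%:R - a%:R = 1 :> R by rewrite ba -natr1 addrC addKr.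
rewrite qx subrr f0 mulr0 addr0 ba1 f1 mulr1 ba.
rewrite [RHS](bigD1 a)//= addrC; congr (_ + _).
by apply: eq_bigl => j; rewrite ltnS ltn_neqAle andbC.
Qed.

Definition digit_iterate (p : 'I_q -> R) (n : nat) : R -> R :=
  iter n (digit_operator p) id.

End operator.

(* Extended-real valued, so that no junk value arises on unbounded functions. *)
Definition sup_norm01 (R : realType) (f : R -> R) : \bar R :=
  ereal_sup [set `|f x|%:E | x in `[0, 1]].

(* Main.v *)
Require Import Defs.
From mathcomp Require Import all_boot all_order all_algebra finmap.
From mathcomp Require Import all_classical all_reals all_analysis.
From mathcomp Require Import measurable_realfun ring lra.

(** The operator [T] glues [q] rescaled copies of [f] along the cells
    [[k/q, (k+1)/q]]. If [f] is extended to the whole line by 0 on the left of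
    [0, 1] and by 1 on its right, the gluing becomes a plain average,
    [T f (y) = \sum_k p_k f (q y - k)], valid for every real [y]: on the cell
    [k], the copies of index [< k] contribute their value 1 and those of index
    [> k] their value 0. This operator is [mixture]; it preserves continuity
    with no case analysis at the breakpoints, and
    [digit_iterate_mixture] identifies [f_n] on [0, 1] with the [n]-th iterate
    [g_n] of [mixture] on [clamp].

    The same operator is the law of one digit. Let [S_n] be the [n]-th partial
    sum of [X]. Conditioning on the first digit shows that
    [y |-> P (S_n < y)] is the [n]-th iterate [W_n] of [mixture] on
    [unit_step], the case [n = 0] being [S_0 = 0] ([partial_sum_law]). Almost
    surely [S_n <= X <= S_n + q^-n], hence
    [W_n (y - q^-n) <= F y <= W_n z] for all [z > y].

    Two functions equal to 0 before 0 and to 1 after 1 differ only inside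
    ]0, 1[, and at most one of the points [q y - k] lies there; so [mixture]
    contracts their uniform distance by the factor [p_max < 1]
    ([mixture_contraction]). Therefore [|W_m - g_n| <= p_max ^ n] as soon as
    [m >= n], because both are [n]-fold images of functions with values in
    [0, 1]. Letting [m] go to infinity and [z] to [y], and using the continuity
    of [g_n], gives [|F - g_n| <= p_max ^ n] on the whole line
    ([squeezed_near_iterate]). Uniform convergence, and with it the continuity
    of [F], follows.

    For the last estimate, put [c = ||x - f_1||]. The contraction gives
    [|g_0 - g_(n+1)| <= |g_0 - g_1| + |mixture g_0 - mixture g_n|
    <= c + p_max |g_0 - g_n|], so [|g_0 - g_n| <= c / (1 - p_max)] by induction
    on [n], and [n] goes to infinity. *)

Import Order.TTheory GRing.Theory Num.Theory.
Import numFieldNormedType.Exports.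

Local Open Scope classical_set_scope.
Local Open Scope ring_scope.

(** * The gluing operator on the whole line *)

Definition unit_ramp {R : realType} (h : R -> R) : Prop :=
  (forall x : R, x <= 0 -> h x = 0) /\ (forall x : R, 1 <= x -> h x = 1).

(** On functions that are 0 before 0 and 1 after 1, the average below is
    [digit_operator] without its case distinction. When [h] is a distribution
    function, it is that of [(k + Y) / q], for a digit [k] of law [p] and an
    independent [Y] of distribution function [h]. *)
Definition mixture {R : realType} {q : nat} (p : 'I_q -> R) (h : R -> R) :
    R -> R :=
  fun x => \sum_(k < q) p k * h (q%:R * x - k%:R).

Definition clamp {R : realType} (x : R) : R := Num.max 0 (Num.min x 1).

(** The strict distribution function [y |-> P (0 < y)] of the constant 0: the
    value 0 at 0 is what makes it a [unit_ramp]. *)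
Definition unit_step {R : realType} (x : R) : R := if 0 < x then 1 else 0.

Section mixture.
Context (R : realType) (q : nat) (p : 'I_q -> R).
Context (q2 : (2 <= q)%N) (p0 : forall j, 0 <= p j) (p1 : \sum_(j < q) p j = 1).

Let q0 : 0 < q%:R :> R. Proof. by rewrite ltr0n (leq_trans _ q2). Qed.
Let i0 : 'I_q := Ordinal (leq_trans (isT : (0 < 2)%N) q2).

Lemma clamp_ramp : unit_ramp (@clamp R).
Proof.
rewrite /clamp; split => x hx.
  by rewrite min_l ?max_l// (le_trans hx).
by rewrite min_r// max_r.
Qed.

Lemma unit_step_ramp : unit_ramp (@unit_step R).
Proof.
rewrite /unit_step; split => x hx; first by rewrite ltNge hx.
by rewrite (lt_le_trans _ hx).
Qed.

Lemma mixture_unit_ramp h : unit_ramp h -> unit_ramp (mixture p h).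
Proof.
move=> [h0 h1]; split=> x hx; rewrite /mixture.
  rewrite big1// => k _; rewrite h0 ?mulr0// subr_le0.
  by rewrite (@le_trans _ _ 0)// pmulr_rle0.
rewrite -[RHS]p1; apply: eq_bigr => k _; rewrite h1 ?mulr1//.
rewrite lerBrDr (@le_trans _ _ q%:R)//; last by rewrite ler_peMr// ltW.
by rewrite nat1r ler_nat.
Qed.

Lemma mixture_in01 h : (forall x, 0 <= h x <= 1) ->
  forall x, 0 <= mixture p h x <= 1.
Proof.
move=> h01 x; apply/andP; split.
  by apply: sumr_ge0 => k _; rewrite mulr_ge0//;
     case/andP: (h01 (q%:R * x - k%:R)).
rewrite -p1; apply: ler_sum => k _.
by rewrite ler_piMr//; case/andP: (h01 (q%:R * x - k%:R)).
Qed.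

(** [h1 - h2] vanishes outside ]0, 1[, and two points [q x - j], [q x - k] of
    this interval of length 1 have [j = k]: a single term of the sum survives,
    whence the factor [M] rather than [\sum_k p k = 1]. *)
Lemma mixture_contraction h1 h2 M c : unit_ramp h1 -> unit_ramp h2 ->
    (forall k, p k <= M) -> 0 <= c ->
    (forall x, `|h1 x - h2 x| <= c) ->
  forall x, `|mixture p h1 x - mixture p h2 x| <= M * c.
Proof.
move=> [h10 h11] [h20 h21] pM c0 hc x.
have M0 : 0 <= M := le_trans (p0 _) (pM i0).
have out y : ~~ (0 < y < 1) -> h1 y - h2 y = 0.
  rewrite negb_and -!leNgt => /orP[y0|y1].
    by rewrite h10 ?h20 ?subrr.
  by rewrite h11 ?h21 ?subrr.
rewrite /mixture -sumrB.
under eq_bigr do rewrite -mulrBr.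
have [[k /andP[k0 k1]]|nk] :=
    pselect (exists k : 'I_q, 0 < q%:R * x - k%:R < 1).
  rewrite (bigD1 k)//= big1 ?addr0 => [|j jk].
    by rewrite normrM (ger0_norm (p0 _)) ler_pM.
  rewrite out ?mulr0//; apply/negP => /andP[j0 j1].
  move/eqP: jk; apply; apply/val_inj => /=.
  (* the integers j and k are both within distance 1 below q x *)
  have lt (a b : 'I_q) :
      0 < q%:R * x - b%:R -> q%:R * x - a%:R < 1 -> (b <= a)%N.
    move=> b0 a1; rewrite -ltnS -(ltr_nat R) -natr1; lra.
  by apply/eqP; rewrite eqn_leq !lt.
rewrite big1 ?normr0 ?mulr_ge0// => k _; rewrite out ?mulr0//.
by apply/negP => hk; apply: nk; exists k.
Qed.

Lemma mixture_continuous h : continuous h -> continuous (mixture p h).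
Proof.
move=> ch; apply: continuous_big => [|k _ x]; first exact: add_continuous.
apply: cvgM; first exact: cvg_cst.
have ck : {for x, continuous (fun x : R => q%:R * x - k%:R : R)}.
  by apply: cvgB; [apply: cvgM => //; exact: cvg_cst|exact: cvg_cst].
exact: (continuous_comp ck (ch _)).
Qed.

Lemma clamp_continuous : continuous (@clamp R).
Proof.
move=> x; apply: (@continuous_max R R (cst 0) ((id : R -> R^o) \min cst 1) x).
  exact: cvg_cst.
apply: (@continuous_min R R id (cst 1) x); [exact: cvg_id|exact: cvg_cst].
Qed.

Lemma iter_mixture_unit_ramp h n :
  unit_ramp h -> unit_ramp (iter n (mixture p) h).
Proof. by move=> hh; elim: n => //= n; exact: mixture_unit_ramp. Qed.

Lemma iter_mixture_in01 h n : (forall x, 0 <= h x <= 1) ->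
  forall x, 0 <= iter n (mixture p) h x <= 1.
Proof. by move=> hh; elim: n => //= n; exact: mixture_in01. Qed.

Lemma iter_mixture_contraction h1 h2 M n : unit_ramp h1 -> unit_ramp h2 ->
    (forall x, 0 <= h1 x <= 1) -> (forall x, 0 <= h2 x <= 1) ->
    (forall k, p k <= M) ->
  forall x, `|iter n (mixture p) h1 x - iter n (mixture p) h2 x| <= M ^+ n.
Proof.
move=> r1 r2 b1 b2 pM.
have M0 : 0 <= M := le_trans (p0 _) (pM i0).
elim: n => [|n IH] x /=.
  move: (b1 x) (b2 x) => /andP[? ?] /andP[? ?].
  by rewrite expr0 ler_norml; lra.
by rewrite exprS; apply: mixture_contraction; rewrite ?exprn_ge0//;
   exact: iter_mixture_unit_ramp.
Qed.

(** On [0, 1] the search for a cell in [digit_operator] succeeds. *)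
Lemma digit_cell_ex (x : R) : 0 <= x <= 1 -> exists k : 'I_q, digit_cell k x.
Proof.
move=> /andP[x0 x1].
suff [k kq kx] : exists2 k, (k < q)%N & k%:R <= q%:R * x <= k.+1%:R.
  exists (Ordinal kq).
  by rewrite /digit_cell ler_pdivrMr// ler_pdivlMr// ![x * _]mulrC.
have : q%:R * x <= q%:R by rewrite ler_piMr// ltW.
have : 0 <= q%:R * x by rewrite mulr_ge0// ltW.
have : (0 < q)%N by rewrite (leq_trans _ q2).
move: (q%:R * x) => z; elim: (q) => // n IH _ z0 zn.
have [nz|zn'] := leP n%:R z; first by exists n => //; rewrite nz.
have n0 : (0 < n)%N by rewrite -(ltr_nat R) (le_lt_trans z0).
by have [k kn kz] := IH n0 z0 (ltW zn'); exists k => //; rewrite ltnW.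
Qed.

Lemma digit_operator_mixture f h : unit_ramp h ->
    (forall x : R, 0 <= x <= 1 -> f x = h x) ->
  forall x : R, 0 <= x <= 1 -> digit_operator p f x = mixture p h x.
Proof.
move=> [h0 h1] fh x x01; rewrite /digit_operator.
case: pickP => [k|nk]; last first.
  by have [k] := digit_cell_ex x x01; rewrite nk.
rewrite /digit_cell ler_pdivrMr// ler_pdivlMr// ![x * _]mulrC -natr1.
move=> /andP[kx xk].
(* the point q x - k lies in [0, 1], where f and h agree *)
rewrite fh; last by apply/andP; split; lra.
rewrite /mixture [RHS](bigID (fun j : 'I_q => j < k)%N)/=; congr (_ + _).
  apply: eq_bigr => j jk; rewrite h1 ?mulr1//.
  by have := jk; rewrite -(ler_nat R) -natr1; lra.
rewrite (bigD1 k)/= ?ltnn// big1 ?addr0// => j /andP[jk /eqP jk'].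
rewrite h0 ?mulr0// subr_le0; apply: le_trans xk _; rewrite natr1 ler_nat.
by rewrite ltn_neqAle leqNgt jk andbT; apply/eqP => /val_inj/esym.
Qed.

Lemma digit_iterate_mixture n (x : R) : 0 <= x <= 1 ->
  digit_iterate p n x = iter n (mixture p) clamp x.
Proof.
elim: n x => [|n IH] x x01 /=.
  by rewrite /clamp/=; case/andP: x01 => x0 x1; rewrite min_l// max_r.
by apply: digit_operator_mixture => //; exact: iter_mixture_unit_ramp clamp_ramp.
Qed.

End mixture.

(** * Partial sums of a digit expansion *)

Section expansion.
Context (R : realType) (q : nat) (q2 : (2 <= q)%N) (u : nat -> R).
Context (ud : forall i, exists k : 'I_q, u i = k%:R).

Let s n : R := \sum_(0 <= i < n) u i * q%:R ^- i.+1.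

(** The partial sums increase while [s k + q^-k] decreases, the digits being at
    most [q - 1]; so the series converges and its limit lies between the two. *)
Lemma expansion_bounds n : s n <= limn s <= s n + q%:R ^- n.
Proof.
have q0 : 0 < q%:R :> R by rewrite ltr0n (leq_trans _ q2).
have w0 k : 0 <= q%:R ^- k :> R by rewrite invr_ge0 exprn_ge0// ltW.
have u0 i : 0 <= u i by have [k ->] := ud i.
have u1 i : u i <= q%:R - 1.
  by have [k ->] := ud i; rewrite lerBrDr natr1 ler_nat.
have s_nd : {homo s : m n / (m <= n)%N >-> m <= n}.
  apply: homo_leq => // [|k]; first exact: le_trans.
  by rewrite /s big_nat_recr//= lerDl mulr_ge0.
have r_ni : {homo (fun k => - (s k + q%:R ^- k)) : m n / (m <= n)%N >-> m <= n}.
  apply: homo_leq => // [|k]; first exact: le_trans.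
  rewrite lerN2 /s big_nat_recr//= -addrA lerD2l.
  have -> : q%:R ^- k = q%:R * q%:R ^- k.+1 :> R.
    by rewrite exprS invfM mulrA mulfV ?mul1r// gt_eqF.
  by rewrite -[X in _ + X <= _]mul1r -mulrDl ler_wpM2r// -lerBrDr.
have sr k : s k <= s n + q%:R ^- n.
  have [kn|nk] := leqP k n.
    by rewrite (le_trans (s_nd _ _ kn))// lerDl.
  by have := r_ni _ _ (ltnW nk); rewrite lerN2; apply: le_trans; rewrite lerDl.
have cs : cvgn s.
  apply: nondecreasing_is_cvgn => //.
  by exists (s n + q%:R ^- n) => _ [k _ <-].
rewrite nondecreasing_cvgn_le//=; apply: limr_le => //.
by apply: nearW.
Qed.

End expansion.

Section law.
Context (R : realType) (q : nat) (q2 : (2 <= q)%N).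
Context (p : 'I_q -> R) (p0 : forall j, 0 <= p j) (p1 : \sum_(j < q) p j = 1).
Context (d : measure_display) (T : measurableType d) (P : probability T R).
Context (x : nat -> {RV P >-> R}) (x_indep : independent_RVs P x).
Context (x_law : forall (i : nat) (j : 'I_q),
  P (x i @^-1` [set j%:R]) = (p j)%:E).

Let mx i (A : set R) : measurable A -> measurable (x i @^-1` A).
Proof. by move=> mA; rewrite -[_ @^-1` _]setTI; exact: measurable_funP. Qed.

Let q0 : 0 < q%:R :> R. Proof. by rewrite ltr0n (leq_trans _ q2). Qed.
Let i0 : 'I_q := Ordinal (leq_trans (isT : (0 < 2)%N) q2).

Definition cylinder m (a : nat -> 'I_q) : set T :=
  \bigcap_(i in `I_m) (x i @^-1` [set (a i)%:R]).

Let mcylinder m a : measurable (cylinder m a).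
Proof.
apply: bigcap_measurableType => // i _; exact: mx.
Qed.

Lemma cylinder_law m a : P (cylinder m a) = (\prod_(i < m) p (a i))%:E.
Proof.
pose J := [fset i | i in iota 0 m]%fset.
have := x_indep J (fun i => [set (a i)%:R]) (fun i _ => @measurable_set1 _ _).
have -> : [set` J] = `I_m.
  by apply/seteqP; split => i /=; rewrite !inE/= mem_iota.
rewrite -/(cylinder m a) => ->; rewrite (perm_big (iota 0 m))/=; last first.
  apply: uniq_perm; [exact: fset_uniq|exact: iota_uniq|].
  by move=> i; rewrite !inE/=.
under eq_bigr do rewrite x_law.
by rewrite prodEFin -[X in iota 0 X]subn0 big_mkord.
Qed.

Definition is_digit m : set T := \big[setU/set0]_(k < q) (x m @^-1` [set k%:R]).

Let digitsP m t : is_digit m t <-> exists k : 'I_q, x m t = k%:R.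
Proof.
rewrite /is_digit -(bigcup_seq (index_enum 'I_q)).
split => [[k _ kt]|[k kt]]; exists k => //=; exact: mem_index_enum.
Qed.

Let mdigits m : measurable (is_digit m).
Proof. by apply: bigsetU_measurable => k _; exact: mx. Qed.

Let digit_triv m E :
  trivIset [set: 'I_q] (fun k : 'I_q => E `&` x m @^-1` [set k%:R]).
Proof.
move=> j k _ _ [t /= [[_ tj] [_ tk]]]; apply/val_inj/eqP.
by rewrite -(eqr_nat R) -tj -tk.
Qed.

Let digitsC0 m : P (~` is_digit m) = 0%E.
Proof.
rewrite probability_setC//.
suff -> : P (is_digit m) = 1%E by rewrite subee.
rewrite /is_digit; rewrite measure_bigsetU_ord//.
  rewrite -[RHS]/(1%:E) -[X in _ = X%:E]p1 -sumEFin.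
  by apply: eq_bigr => k _; exact: x_law.
by have := digit_triv m setT; under eq_fun do rewrite setTI.
Qed.

(** The values [0, ..., q - 1] already carry the total mass 1 of [x m]. *)
Lemma total_probability m E : measurable E ->
  P E = (\sum_(k < q) P (E `&` x m @^-1` [set k%:R]))%E.
Proof.
move=> mE.
transitivity (P (\big[setU/set0]_(k < q) (E `&` x m @^-1` [set k%:R])));
  last first.
  apply: measure_bigsetU_ord => [k|]; last exact: digit_triv.
  by apply: measurableI => //; exact: mx.
rewrite (measureDI P mE (mdigits m)).
rewrite [X in (X + _)%E](_ : _ = 0%E) ?add0e; last first.
  apply: (subset_measure0 _ _ _ (digitsC0 m)).
  - exact: measurableD.
  - exact: measurableC.
  - by move=> t [].
congr (P _); apply/seteqP; split => t.
  move=> [Et /digitsP[k tk]].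
  rewrite -(bigcup_seq (index_enum 'I_q)).
  by exists k => //=; exact: mem_index_enum.
rewrite -(bigcup_seq (index_enum 'I_q)) => -[k _ [Et tk]]; split => //.
by apply/digitsP; exists k.
Qed.

Definition block_sum m n (t : T) : R :=
  \sum_(0 <= i < n) x (m + i)%N t * q%:R ^- i.+1.

Let mblock_sum m n y : measurable [set t | block_sum m n t < y].
Proof.
have mf : measurable_fun [set: T] (block_sum m n).
  by apply: measurable_sum => i; exact: measurable_funM.
rewrite (_ : [set t | _] = block_sum m n @^-1` `]-oo, y[).
  by rewrite -[_ @^-1` _]setTI; exact: mf.
by apply/seteqP; split => t /=; rewrite in_itv.
Qed.

Lemma block_sumS m n t :
  block_sum m n.+1 t = (x m t + block_sum m.+1 n t) / q%:R.
Proof.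
rewrite /block_sum big_nat_recl//= addn0 expr1 mulrDl; congr (_ + _).
rewrite mulr_suml; apply: eq_bigr => i _.
by rewrite addnS addSn [in LHS]exprS invfM -mulrA [_^-1 * _]mulrC.
Qed.

(** Reading one more digit turns the event [block_sum m n.+1 < y] into
    [block_sum m.+1 n < q y - k], on which the law of the remaining [n] digits
    is known by induction. The cylinder carries the digits already read; keeping
    it in the statement reduces independence to the product rule for
    cylinders. *)
Lemma block_law n m a y :
  P (cylinder m a `&` [set t | block_sum m n t < y]) =
  (\prod_(i < m) p (a i) * iter n (mixture p) unit_step y)%:E.
Proof.
elim: n m a y => [|n IH] m a y.
  have b0 t : block_sum m 0 t = 0 by rewrite /block_sum big_geq.
  rewrite /= /unit_step; case: ifPn => y0.
    rewrite (_ : [set t | _] = setT) ?setIT ?cylinder_law ?mulr1//.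
    by apply/seteqP; split => t //= _; rewrite b0.
  rewrite (_ : [set t | _] = set0) ?setI0 ?measure0 ?mulr0//.
  by apply/seteqP; split => t //=; rewrite b0 (negPf y0).
have mE := measurableI _ _ (mcylinder m a) (mblock_sum m n.+1 y).
rewrite (total_probability m _ mE).
rewrite iterS {1}/mixture mulr_sumr -sumEFin.
apply: eq_bigr => k _.
pose b i := if i == m then k else a i.
have -> : cylinder m a `&` [set t | block_sum m n.+1 t < y] `&`
    x m @^-1` [set k%:R] =
    cylinder m.+1 b `&` [set t | block_sum m.+1 n t < q%:R * y - k%:R].
  have bs t : x m t = k%:R ->
      (block_sum m n.+1 t < y) = (block_sum m.+1 n t < q%:R * y - k%:R).
    by move=> tk; rewrite block_sumS tk ltr_pdivrMr// [y * _]mulrC ltrBrDl.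
  apply/seteqP; split => t /=.
    move=> [[ct ty] tk]; split; last by rewrite -bs.
    move=> i /=; rewrite ltnS leq_eqVlt /b; case: eqP => [->//|_ /= im].
    exact: ct.
  move=> [ct ty].
  have tk : x m t = k%:R by have := ct m (ltnSn m); rewrite /b eqxx.
  split => //; split; last by rewrite bs.
  move=> i /= im; have := ct i (ltnW im); rewrite /b ltn_eqF//.
rewrite IH big_ord_recr/= /b eqxx mulrA.
by under eq_bigr => i _ do rewrite ltn_eqF//.
Qed.

Lemma partial_sum_law n y :
  P [set t | \sum_(0 <= i < n) x i t * q%:R ^- i.+1 < y] =
  (iter n (mixture p) unit_step y)%:E.
Proof.
have := block_law n 0 (fun=> i0) y.
have -> : cylinder 0 (fun=> i0) = setT by apply/seteqP; split.
by rewrite setTI big_ord0 mul1r.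
Qed.

Lemma probability_le_on_digits A B : measurable A -> measurable B ->
  (forall t, (forall i, exists k : 'I_q, x i t = k%:R) -> A t -> B t) ->
  (P A <= P B)%E.
Proof.
move=> mA mB AB.
pose N := \bigcup_i ~` is_digit i.
have mN : measurable N by apply: bigcup_measurable => i _; exact: measurableC.
have N0 : P N = 0%E.
  apply: measure_negligible => //; apply: negligible_bigcup => i.
  by exists (~` is_digit i); split=> //; [exact: measurableC|exact: digitsC0].
rewrite -(measureU0 mB mN N0); apply: le_measure; rewrite ?inE//.
  exact: measurableU.
move=> t At; have [Nt|nNt] := pselect (N t); [by right|left].
apply: AB At => i; apply/digitsP; apply: contrapT => di.
by apply: nNt; exists i.
Qed.

Let X : {RV P >-> R} := digit_series q x.
Let F r : R := fine (cdf X r).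

(** [S_n < y - q^-n] forces [X <= y], the tail being at most [q^-n]. *)
Lemma iterate_le_cdf n y : iter n (mixture p) unit_step (y - q%:R ^- n) <= F y.
Proof.
rewrite -lee_fin -partial_sum_law /F fineK; last exact: fin_num_measure.
apply: probability_le_on_digits.
- by have := mblock_sum 0 n (y - q%:R ^- n).
- by rewrite -[_ @^-1` _]setTI; exact: measurable_funP.
move=> t td /=; rewrite in_itv/= => tn.
have /andP[_ Xt] := expansion_bounds R q q2 (fun i => x i t) td n.
by rewrite (le_trans Xt)//; lra.
Qed.

(** [X <= y < z] forces [S_n < z]. The gap between [y] and [z] absorbs the
    difference between non-strict and strict inequalities, that is, possible
    atoms. *)
Lemma cdf_le_iterate n y z : y < z -> F y <= iter n (mixture p) unit_step z.
Proof.
move=> yz; rewrite -lee_fin -partial_sum_law /F fineK; last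
  exact: fin_num_measure.
apply: probability_le_on_digits.
- by rewrite -[_ @^-1` _]setTI; exact: measurable_funP.
- by have := mblock_sum 0 n z.
move=> t td /=; rewrite in_itv/= => Xt.
have /andP[tX _] := expansion_bounds R q q2 (fun i => x i t) td n.
by rewrite (le_lt_trans tX)// (le_lt_trans Xt).
Qed.

End law.

(** * Uniform approximation of the distribution function *)

Lemma uniform_limit_continuous (R : realType) (g : nat -> R -> R) (F : R -> R)
    (e : nat -> R) :
  (forall n, continuous (g n)) -> (forall n y, `|F y - g n y| <= e n) ->
  e n @[n --> \oo] --> 0 -> continuous F.
Proof.
move=> cg Fg e0 y; apply/cvgrPdist_lt => eps eps0.
have eps3 : 0 < eps / 3 by rewrite divr_gt0.
have [N _ /(_ N (leqnn N)) eN] := cvgr0_norm_lt _ e0 _ eps3.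
have gy : \forall z \near y, `|g N y - g N z| < eps / 3.
  by move/cvgrPdist_lt: (cg N y); exact.
near=> z.
have gz : `|g N y - g N z| < eps / 3 by near: z.
move: (Fg N y) (Fg N z) gz eN; rewrite !ler_norml !ltr_norml.
move=> /andP[? ?] /andP[? ?] /andP[? ?] /andP[? ?].
by apply/andP; split; lra.
Unshelve. all: by end_near. Qed.

Lemma clamp01 {R : realType} (x : R) : 0 <= clamp x <= 1.
Proof. by rewrite /clamp le_max lexx /= ge_max ler01 ge_min lexx orbT. Qed.

Lemma unit_step01 {R : realType} (x : R) : 0 <= unit_step x <= 1.
Proof. by rewrite /unit_step; case: ifP; rewrite ?lexx ?ler01. Qed.

Section limit.
Context (R : realType) (q : nat) (q2 : (2 <= q)%N).
Context (p : 'I_q -> R) (p0 : forall j, 0 <= p j) (p1 : \sum_(j < q) p j = 1).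
Context (M : R) (pM : forall k, p k <= M).

(** For [m >= n], the [m]-th iterate on [unit_step] is the [n]-fold image of a
    function with values in [0, 1], hence within [M ^+ n] of the [n]-th iterate
    on [clamp]. The shifts [q^-m] and [z - y] in the hypotheses on [F] can then
    be made as small as desired, with [n] fixed, by continuity of the latter. *)
Lemma squeezed_near_iterate (F : R -> R) :
    (forall n y, iter n (mixture p) unit_step (y - q%:R ^- n) <= F y) ->
    (forall n y z, y < z -> F y <= iter n (mixture p) unit_step z) ->
  forall n y, `|F y - iter n (mixture p) clamp y| <= M ^+ n.
Proof.
move=> FW WF n y.
set g := iter n (mixture p) clamp.
have Wg m z : (n <= m)%N -> `|iter m (mixture p) unit_step z - g z| <= M ^+ n.
  move=> nm; rewrite -(subnKC nm) iterD.
  apply: iter_mixture_contraction => //.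
  - by apply: iter_mixture_unit_ramp => //; exact: unit_step_ramp.
  - exact: clamp_ramp.
  - by apply: iter_mixture_in01 => //; exact: unit_step01.
  - exact: clamp01.
have cg : continuous g.
  rewrite /g; elim: (n) => [|k IH]; first exact: clamp_continuous.
  exact: mixture_continuous.
apply/ler_addgt0Pr => e e0.
have [r /= r0 gr] : \forall z \near y, `|g y - g z| < e.
  by move/cvgrPdist_lt: (cg y); exact.
have qV : q%:R ^- k @[k --> \oo] --> (0 : R).
  under eq_fun do rewrite -exprVn.
  apply: cvg_expr; rewrite ger0_norm ?invr_ge0//.
  by rewrite invf_lt1 ?ltr1n ?ltr0n// (leq_trans _ q2).
have [m nm qm] : exists2 m, (n <= m)%N & `|q%:R ^- m| < r.
  have [K _ hK] := cvgr0_norm_lt _ qV _ r0.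
  by exists (maxn n K); [exact: leq_maxl|apply: hK; exact: leq_maxr].
rewrite ler_norml; apply/andP; split.
  have := FW m y; have := Wg m (y - q%:R ^- m) nm.
  have : `|g y - g (y - q%:R ^- m)| < e.
    by apply: gr; rewrite /= opprB addrC subrK.
  by rewrite ltr_norml ler_norml => /andP[? ?] /andP[? ?]; lra.
have yz : y < y + r / 2 by rewrite ltrDl divr_gt0.
have := WF n _ _ yz; have := Wg n (y + r / 2) (leqnn n).
have : `|g y - g (y + r / 2)| < e.
  apply: gr; rewrite /= opprD addrA subrr sub0r normrN gtr0_norm ?divr_gt0//.
  lra.
by rewrite ltr_norml ler_norml => /andP[? ?] /andP[? ?]; lra.
Qed.

(** Writing [b] for the bound, [b = c + M * b]: one step costs [c] and the
    contraction multiplies the bound for [n] steps by [M]. *)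
Lemma clamp_sub_iterate c n : M < 1 -> 0 <= c ->
    (forall y, `|clamp y - mixture p clamp y| <= c) ->
  forall y, `|clamp y - iter n (mixture p) clamp y| <= c / (1 - M).
Proof.
move=> M1 c0 hc; have d0 : 0 < 1 - M by rewrite subr_gt0.
have cd0 : 0 <= c / (1 - M) by rewrite divr_ge0// ltW.
elim: n => [|n IH] y /=; first by rewrite subrr normr0.
rewrite (le_trans (ler_distD (mixture p clamp y) _ _))//.
have -> : c / (1 - M) = c + M * (c / (1 - M)) by field; rewrite gt_eqF.
apply: lerD => //; apply: mixture_contraction => //; first exact: clamp_ramp.
exact/iter_mixture_unit_ramp/clamp_ramp.
Qed.

End limit.

Lemma sup_norm01_le (R : realType) (f : R -> R) (c : R) :
  (forall x, 0 <= x <= 1 -> `|f x| <= c) <-> (sup_norm01 f <= c%:E)%E.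
Proof.
split=> [fc|fc x x01].
  by apply: ge_ereal_sup => _ [x /= x01 <-]; rewrite lee_fin fc.
rewrite -lee_fin; apply: le_trans fc; apply: ereal_sup_ubound.
by exists x.
Qed.

Lemma sup_norm01_ge0 (R : realType) (f : R -> R) : (0 <= sup_norm01 f)%E.
Proof.
apply: (@le_trans _ _ `|f 0|%:E); first by rewrite lee_fin.
by apply: ereal_sup_ubound; exists 0 => //=; rewrite in_itv/= lexx ler01.
Qed.

Theorem theorem4p1 (R : realType) (q : nat) (hq : (2 <= q)%N)
  (p : 'I_q -> R) (p_ge0 : forall j, 0 <= p j)
  (p_sum : \sum_(j < q) p j = 1) (p_neq1 : forall j, p j != 1)
  (d : measure_display) (T : measurableType d) (P : probability T R)
  (x : nat -> {RV P >-> R}) (x_indep : independent_RVs P x)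
  (x_law : forall (i : nat) (j : 'I_q), P (x i @^-1` [set j%:R]) = (p j)%:E) :
  let p_max := \big[Num.max/0]_(j < q) p j in
  let F : R -> R := fun r => fine (cdf (digit_series q x : {RV P >-> R}) r) in
  let f := digit_iterate p in
  [/\ forall n, {within `[0, 1], continuous (f n)},
      {within `[0, 1], continuous F},
      sup_norm01 (fun r => f n r - F r) @[n --> \oo] --> 0%E
    & (sup_norm01 (fun r => (r - F r)%R) <=
       (1 / (1 - p_max))%:E * sup_norm01 (fun r => (r - f 1%N r)%R))%E].
Proof.
move=> M F f.
pose g n := iter n (mixture p) clamp.
have fg n r : 0 <= r <= 1 -> f n r = g n r by exact: digit_iterate_mixture.
have pM k : p k <= M by exact: le_bigmax.
have M0 : 0 <= M by exact: le_trans (p_ge0 (Ordinal hq)) (pM _).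
have M1 : M < 1.
  apply/bigmax_ltP; split=> // k _.
  rewrite lt_neqAle p_neq1/= -p_sum (bigD1 k)//= lerDl.
  exact: sumr_ge0.
have cg n : continuous (g n).
  by elim: n => [|n IH]; [exact: clamp_continuous|exact: mixture_continuous].
have FM : forall n y, `|F y - g n y| <= M ^+ n.
  apply: squeezed_near_iterate => //.
  - by move=> n y; exact: iterate_le_cdf.
  - by move=> n y z; exact: cdf_le_iterate.
have Mn0 : M ^+ n @[n --> \oo] --> 0 by apply: cvg_expr; rewrite ger0_norm.
split.
- move=> n; apply: (subspace_eq_continuous _ (continuous_subspaceT (cg n))).
  by move=> r; rewrite inE/= in_itv/= => r01; exact/esym/fg.
- exact/continuous_subspaceT/(uniform_limit_continuous _ _ _ _ cg FM Mn0).
- apply: (@squeeze_cvge _ _ _ _ (cst 0%E) _ (fun n => (M ^+ n)%:E)).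
  + apply: nearW => n; rewrite sup_norm01_ge0/=; apply/sup_norm01_le => r r01.
    by rewrite fg// distrC.
  + exact: cvg_cst.
  + by apply: cvg_EFin; [exact: nearW|exact: Mn0].
set s := sup_norm01 (fun r => r - f 1%N r).
have clampE (r : R) : 0 <= r <= 1 -> clamp r = r.
  by move=> r01; rewrite -[clamp r]/(g 0%N r) -fg.
have s_fin : s = (fine s)%:E.
  rewrite fineK// ge0_fin_numE ?sup_norm01_ge0//.
  apply: (@le_lt_trans _ _ 1%E); last by rewrite ltry.
  apply/sup_norm01_le => r r01; rewrite fg// -{1}(clampE r r01).
  have := iter_mixture_in01 R q p p_ge0 p_sum clamp 1 clamp01 r.
  rewrite -/(g 1 r); move: (clamp01 r) => /andP[? ?] /andP[? ?].
  by rewrite ler_norml; lra.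
have s0 : 0 <= fine s by rewrite fine_ge0// sup_norm01_ge0.
(* outside ]0, 1[ both functions coincide, so the bound on [0, 1] is global *)
have hs y : `|clamp y - mixture p clamp y| <= fine s.
  have [[c0 c1] [m0 m1]] : unit_ramp (@clamp R) /\ unit_ramp (mixture p clamp).
    by split; [|apply: mixture_unit_ramp => //]; exact: clamp_ramp.
  have [y0|y0] := leP y 0; first by rewrite c0// m0// subrr normr0.
  have [y1|y1] := leP 1 y; first by rewrite c1// m1// subrr normr0.
  have y01 : 0 <= y <= 1 by rewrite !ltW.
  rewrite {1}clampE// -[mixture p clamp y]/(g 1 y) -fg//.
  apply: ((sup_norm01_le R (fun r => r - f 1%N r) (fine s)).2 _ y y01).
  by rewrite -s_fin.
rewrite s_fin -EFinM mul1r mulrC; apply/sup_norm01_le => r r01.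
apply/ler_addgt0Pr => e e0.
have [N _ /(_ N (leqnn N)) eN] := cvgr0_norm_lt _ Mn0 _ e0.
rewrite (le_trans (ler_distD (g N r) _ _))// lerD//.
  by rewrite -{1}(clampE r r01); exact: clamp_sub_iterate.
rewrite distrC (le_trans (FM N r))//.
by rewrite (le_trans (ler_norm _))// ltW.
Qed.
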